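(* Let $\mathcal Z\subseteq\mathbb R^m$ be nonempty, convex and closed, let $\theta_t\in\Theta$, and let $\mathbb B(\hat{\mathbb P}(\theta_t))$ be the type-2 Wasserstein ball of radius $\rho$ around $\hat{\mathbb P}(\theta_t)$ with ground cost given by the Euclidean norm. Suppose that for every $\theta$ the function $z\mapsto\ell(z,\theta)$ is proper, concave and upper semicontinuous. For a constant $\tau>0$ consider the finite convex program $$\begin{array}{cl} \inf & \displaystyle\sum_{s\in[S]}\hat p_s(\theta_t)\Big([-\ell]^*(r_s-\zeta_s,\theta)+\sigma_{\mathcal Z}(\zeta_s)-r_s^\top\hat z_s+\frac1{4\lambda}\|r_s\|_2^2\Big)+\rho^2\lambda+\tau\lambda^2\\ \text{s.t.} & \theta\in\Theta,\ \lambda\in\mathbb R_+,\ r_s\in\mathbb R^m,\ \zeta_s\in\mathbb R^m\quad\forall s\in[S]. \end{array}$$ Then the optimal value of this program is an arbitrarily tight conservative approximation of $$\min_{\theta\in\Theta}\ \sup_{\mathbb Q\in\mathbb B(\hat{\mathbb P}(\theta_t))}\mathbb E_{\mathbb Q}[\ell(\tilde z,\theta)] ;$$ that is, for every $\tau>0$ it is an upper bound on the optimal value of this problem, and the gap can be made arbitrarily small by choosing $\tau$ small enough.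
   Context: $[S]=\{1,\dots,S\}$; $\Theta\subseteq\mathbb R^d$ is the decision set. The reference distribution is $\hat{\mathbb P}(\theta)=\sum_{s=1}^S\hat p_s(\theta)\delta_{\hat z_s(\theta)}$ with scenarios $\hat z_s(\theta)\in\mathcal Z$, $\hat p_s(\theta)\ge0$, $\sum_s\hat p_s(\theta)=1$; in the program $\hat z_s=\hat z_s(\theta_t)$. Standing assumption: $\theta\mapsto\ell(z,\theta)$ is convex for every fixed $z\in\mathcal Z$. $[-\ell]^*(\xi,\theta)=\sup_{z\in\mathbb R^m}\ \xi^\top z-[-\ell(z,\theta)]$ is the conjugate of $-\ell$ with respect to $z$, and $\sigma_{\mathcal Z}(\xi)=\sup_{z\in\mathcal Z}\xi^\top z$ is the support function of $\mathcal Z$. For $\lambda=0$ the term $\frac1{4\lambda}\|r\|_2^2$ is read as $0$ if $r=0$ and $+\infty$ otherwise. The type-2 Wasserstein distance is $W_2(\mathbb Q_1,\mathbb Q_2)=\big(\inf_\pi\int\|z_1-z_2\|_2^2\,\pi(\mathrm dz_1,\mathrm dz_2)\big)^{1/2}$ over couplings $\pi$ of $\mathbb Q_1,\mathbb Q_2$, and $\mathbb B(\hat{\mathbb P}(\theta_t))$ is the set of probability distributions $\mathbb Q$ on $\mathcal Z$ with finite second moment and $W_2(\mathbb Q,\hat{\mathbb P}(\theta_t))\le\rho$, where $\rho\ge0$ is the radius. *)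

(* Defs.v *)
From HB Require Import structures.
From mathcomp Require Import all_boot all_order all_algebra.
From mathcomp Require Import all_classical all_reals all_analysis.
Set Implicit Arguments.
Unset Strict Implicit.
Unset Printing Implicit Defensive.
Import Order.TTheory GRing.Theory Num.Theory.
Import numFieldNormedType.Exports.
Local Open Scope classical_set_scope.
Local Open Scope ring_scope.
Local Open Scope ereal_scope.

(* The norm the library puts on 'rV[R]_n is the sup norm, hence the explicit
   Euclidean inner product and norm.  The topologies coincide. *)
Definition dotv (R : realType) (n : nat) (u v : 'rV[R]_n) : R :=
  (\sum_(i < n) u ord0 i * v ord0 i)%R.

Definition l2norm (R : realType) (n : nat) (u : 'rV[R]_n) : R :=
  Num.sqrt (dotv u u).

(* Convexity of an extended-real-valued function is convexity of its epigraph,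
   so that no convention for +oo - oo is involved. *)
Definition epigraph (R : realType) (n : nat) (f : 'rV[R]_n -> \bar R) :
    set ('rV[R]_n * R^o) :=
  [set xa | f xa.1 <= (xa.2 : R)%:E].

Definition econvex (R : realType) (n : nat) (f : 'rV[R]_n -> \bar R) : Prop :=
  convex_set (epigraph f).

Definition econcave (R : realType) (n : nat) (f : 'rV[R]_n -> \bar R) : Prop :=
  econvex (fun x => - f x).

(* Properness in the sense of concave functions, i.e. properness of -f. *)
Definition proper_concave (R : realType) (n : nat)
    (f : 'rV[R]_n -> \bar R) : Prop :=
  (forall x, f x < +oo) /\ (exists x, -oo < f x).

Definition upper_semicontinuous (R : realType) (n : nat)
    (f : 'rV[R]_n -> \bar R) : Prop :=
  lower_semicontinuous (fun x => - f x).

Definition conjugate (R : realType) (n : nat) (f : 'rV[R]_n -> \bar R)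
    (xi : 'rV[R]_n) : \bar R :=
  ereal_sup [set (dotv xi z)%:E - f z | z in [set: 'rV[R]_n]].

Definition support_fun (R : realType) (n : nat) (Z : set 'rV[R]_n)
    (xi : 'rV[R]_n) : \bar R :=
  ereal_sup [set (dotv xi z)%:E | z in Z].

(* R^n with its Borel sigma-algebra. *)
Definition borelRV (R : realType) (n : nat) : measurableType _ :=
  g_sigma_algebraType (@open 'rV[R]_n).

Definition is_coupling (R : realType) (n : nat)
    (Q1 Q2 : probability (borelRV R n) R)
    (pi : probability (borelRV R n * borelRV R n)%type R) : Prop :=
  (forall A, measurable A -> pi (A `*` setT) = Q1 A) /\
  (forall A, measurable A -> pi (setT `*` A) = Q2 A).

Definition W2 (R : realType) (n : nat)
    (Q1 Q2 : probability (borelRV R n) R) : \bar R :=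
  sqrte (ereal_inf
    [set \int[pi]_x (l2norm ((x.1 : 'rV[R]_n) - (x.2 : 'rV[R]_n))%R ^+ 2)%:E
    | pi in [set pi | is_coupling Q1 Q2 pi]]).

Definition W2_ball (R : realType) (n : nat) (Z : set 'rV[R]_n)
    (P : probability (borelRV R n) R) (rho : R) :
    set (probability (borelRV R n) R) :=
  [set Q : probability (borelRV R n) R | [/\ Q Z = 1,
               \int[Q]_z (l2norm (z : 'rV[R]_n) ^+ 2)%:E < +oo &
               W2 Q P <= rho%:E]].

(* P is the discrete distribution \sum_s p_s \d_(z_s). *)
Definition is_discrete_law (R : realType) (n k : nat) (p : 'I_k -> R)
    (z : 'I_k -> 'rV[R]_n) (P : probability (borelRV R n) R) : Prop :=
  forall A : set (borelRV R n), measurable A ->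
    P A = \sum_(s < k) (p s)%:E * \d_(z s : borelRV R n) A.

Definition dro_value (R : realType) (m d : nat) (Z : set 'rV[R]_m)
    (Theta : set 'rV[R]_d) (l : 'rV[R]_m -> 'rV[R]_d -> \bar R)
    (P : probability (borelRV R m) R) (rho : R) : \bar R :=
  ereal_inf [set ereal_sup [set \int[Q]_z l z th | Q in W2_ball Z P rho]
            | th in Theta].

(* |r|^2 / (4 lambda), with its lower semicontinuous extension at 0. *)
Definition quad_over (R : realType) (n : nat) (lambda : R) (r : 'rV[R]_n) :
    \bar R :=
  if lambda == 0%R then (if r == 0%R then 0 else +oo)
  else ((4 * lambda)^-1 * l2norm r ^+ 2)%:E.

(* 0 * +oo = 0 here: a scenario of weight zero does not contribute.  No
   bracket mixes +oo and -oo when -l(., th) is proper and Z is nonempty. *)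
Definition program_objective (R : realType) (m d k : nat) (Z : set 'rV[R]_m)
    (l : 'rV[R]_m -> 'rV[R]_d -> \bar R) (p : 'I_k -> R)
    (zhat : 'I_k -> 'rV[R]_m) (rho tau : R) (th : 'rV[R]_d) (lambda : R)
    (r zeta : 'I_k -> 'rV[R]_m) : \bar R :=
  \sum_(s < k) (p s)%:E *
     (conjugate (fun z => - l z th) (r s - zeta s)%R + support_fun Z (zeta s)
      - (dotv (r s) (zhat s))%:E + quad_over lambda (r s))
  + (rho ^+ 2 * lambda)%:E + (tau * lambda ^+ 2)%:E.

Definition program_value (R : realType) (m d k : nat) (Z : set 'rV[R]_m)
    (Theta : set 'rV[R]_d) (l : 'rV[R]_m -> 'rV[R]_d -> \bar R)
    (p : 'I_k -> R) (zhat : 'I_k -> 'rV[R]_m) (rho tau : R) : \bar R :=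
  ereal_inf [set v | exists th lambda r zeta,
    [/\ Theta th, (0 <= lambda)%R &
        v = program_objective Z l p zhat rho tau th lambda r zeta]].

(* Main.v *)
Require Import Defs.
From HB Require Import structures.
From mathcomp Require Import all_boot all_order all_algebra.
From mathcomp Require Import all_classical all_reals all_analysis.
From mathcomp Require Import measurable_realfun.
From mathcomp Require Import ring lra.
Import Order.TTheory GRing.Theory Num.Theory.
Import numFieldNormedType.Exports.
Local Open Scope classical_set_scope.
Local Open Scope ring_scope.
Set Implicit Arguments.
Unset Strict Implicit.
Unset Printing Implicit Defensive.

(** Fix a decision th and write g = l(., th) and f = - g, with weights p_s and
    scenarios z_s = zhat_s(theta_t).

    The program is an upper bound by weak duality ([weak_duality_program]).
    The Fenchel-Young inequality in each of its three terms shows that the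
    bracket b_s of scenario s satisfies
    g(y) <= b_s + lambda |y - z_s|^2 for every y in Z.  Integrating this against
    an almost optimal coupling of Q and the reference distribution gives
    E_Q[g] <= \sum_s p_s b_s + lambda rho^2.

    For the converse ([program_strong_duality]), let c be a real larger than the
    worst-case expectation.  Testing only distributions \sum_s p_s \d_(x_s) with
    x_s in Z shows that \sum_s p_s a_s < c whenever a_s <= g(x_s) and
    \sum_s p_s |x_s - z_s|^2 <= rho^2 ([worst_case_lt]).  This finite-dimensional
    problem is dualised by a quadratic penalty instead of by separation
    theorems: over points (x_s, a_s) of the epigraph of f and copies y_s in Z one
    minimises
      \sum_s p_s a_s + N (\sum_s p_s |x_s - y_s|^2 + max(0, e)^2),
      e = \sum_s p_s |x_s - z_s|^2 - rho^2.
    The minimum is attained, because f has a quadratic minorant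
    ([convex_quadratic_minorant]) while the penalty is quartic in x, and it
    exceeds - c once N is large ([penalized_lower_bound]).  The first-order
    conditions at a minimiser hand over the dual variables
      lambda = 2 N max(0, e),  zeta_s = 2 N (x_s - y_s),
      r_s = - 2 lambda (x_s - z_s),
    and at these the dual objective without the tau term is
      - (\sum_s p_s a_s + 2 N \sum_s p_s |x_s - y_s|^2 + lambda e),
    which is at most minus the penalised minimum, hence less than c
    ([penalty_duality]).

    Since lambda is a fixed finite number, adding tau lambda^2 keeps the value
    below c for small tau, which is the convergence. *)

(** * The Euclidean inner product *)

Lemma dotvC (R : realType) (n : nat) (u v : 'rV[R]_n) : dotv u v = dotv v u.
Proof. by apply: eq_bigr => i _; rewrite mulrC. Qed.

Lemma dotvDl (R : realType) (n : nat) (u v w : 'rV[R]_n) :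
  dotv (u + v) w = dotv u w + dotv v w.
Proof.
by rewrite /dotv -big_split; apply: eq_bigr => i _; rewrite /= mxE mulrDl.
Qed.

Lemma dotvZl (R : realType) (n : nat) (t : R) (u w : 'rV[R]_n) :
  dotv (t *: u) w = t * dotv u w.
Proof.
by rewrite /dotv mulr_sumr; apply: eq_bigr => i _; rewrite /= mxE mulrA.
Qed.

Lemma dotvDr (R : realType) (n : nat) (u v w : 'rV[R]_n) :
  dotv u (v + w) = dotv u v + dotv u w.
Proof. by rewrite dotvC dotvDl !(dotvC u). Qed.

Lemma dotvZr (R : realType) (n : nat) (t : R) (u w : 'rV[R]_n) :
  dotv u (t *: w) = t * dotv u w.
Proof. by rewrite dotvC dotvZl dotvC. Qed.

Lemma dotvNl (R : realType) (n : nat) (u w : 'rV[R]_n) :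
  dotv (- u) w = - dotv u w.
Proof. by rewrite -scaleN1r dotvZl mulN1r. Qed.

Lemma dotvNr (R : realType) (n : nat) (u w : 'rV[R]_n) :
  dotv u (- w) = - dotv u w.
Proof. by rewrite dotvC dotvNl dotvC. Qed.

Lemma dotvNN (R : realType) (n : nat) (u : 'rV[R]_n) :
  dotv (- u) (- u) = dotv u u.
Proof. by rewrite dotvNl dotvNr opprK. Qed.

Definition dotvE := (dotvDl, dotvDr, dotvNl, dotvNr, dotvZl, dotvZr).

Lemma dotv0l (R : realType) (n : nat) (u : 'rV[R]_n) : dotv 0 u = 0.
Proof. by rewrite -(scale0r 0) dotvZl mul0r. Qed.

Lemma dotv_ge0 (R : realType) (n : nat) (u : 'rV[R]_n) : 0 <= dotv u u.
Proof. by apply: sumr_ge0 => i _; rewrite -expr2 sqr_ge0. Qed.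

Lemma dotv_eq0 (R : realType) (n : nat) (u : 'rV[R]_n) : dotv u u = 0 -> u = 0.
Proof.
move=> /eqP; rewrite psumr_eq0 => [/allP u0|i _]; last by rewrite -expr2 sqr_ge0.
apply/rowP => i; rewrite mxE; apply/eqP; rewrite -sqrf_eq0 expr2.
exact: (u0 i (mem_index_enum i)).
Qed.

Lemma l2norm_sqr (R : realType) (n : nat) (u : 'rV[R]_n) :
  l2norm u ^+ 2 = dotv u u.
Proof. by rewrite /l2norm sqr_sqrtr// dotv_ge0. Qed.

Lemma coord_sqr_le (R : realType) (n : nat) (u : 'rV[R]_n) (i : 'I_n) :
  u ord0 i ^+ 2 <= dotv u u.
Proof.
rewrite /dotv (bigD1 i)//= -expr2 lerDl; apply: sumr_ge0 => j _.
by rewrite -expr2 sqr_ge0.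
Qed.

Definition sqdist (R : realType) (n : nat) (x y : 'rV[R]_n) : R :=
  dotv (x - y) (x - y).

Lemma sqdist_ge0 (R : realType) (n : nat) (x y : 'rV[R]_n) : 0 <= sqdist x y.
Proof. exact: dotv_ge0. Qed.

Lemma dotv_dist_triangle (R : realType) (n : nat) (x y z : 'rV[R]_n) :
  dotv (x - z) (x - z) <= 2 * dotv (x - y) (x - y) + 2 * dotv (y - z) (y - z).
Proof.
have := dotv_ge0 ((x - y) - (y - z)); rewrite !dotvE.
rewrite (dotvC y x) (dotvC z x) (dotvC z y); lra.
Qed.

(** * Continuity and compactness *)

Lemma continuous_sumr (R : realType) (T : topologicalType) (I : finType)
    (f : I -> T -> R) :
  (forall i, continuous (f i)) -> continuous (fun t => \sum_i f i t).
Proof.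
move=> cf t; elim: (index_enum I) => [|i s IH].
  by under eq_fun do rewrite big_nil; exact: cvg_cst.
under eq_fun do rewrite big_cons.
by apply: cvgD => //; exact: cf.
Qed.

Lemma continuous_dotv (R : realType) (n : nat) (T : topologicalType)
    (f g : T -> 'rV[R]_n) :
  continuous f -> continuous g -> continuous (fun t => dotv (f t) (g t)).
Proof.
move=> cf cg; apply: continuous_sumr => i.
have cc (h : T -> 'rV[R]_n) : continuous h -> continuous (fun t => h t ord0 i).
  move=> ch t; apply: (@continuous_comp _ _ _ h (fun M : 'rV[R]_n => M ord0 i)).
    exact: ch.
  exact: coord_continuous.
by move=> t; apply: cvgM; exact: cc.
Qed.

Lemma continuous_dist (R : realType) (n : nat) (T : topologicalType)
    (f g : T -> 'rV[R]_n) : continuous f -> continuous g ->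
  continuous (fun t => dotv (f t - g t) (f t - g t)).
Proof.
move=> cf cg; have cfg : continuous (fun t => f t - g t).
  by move=> t; apply: cvgB; [exact: cf|exact: cg].
exact: continuous_dotv.
Qed.

Lemma fst_continuous (U V : topologicalType) : continuous (@fst U V).
Proof. by move=> [x y]; exact: cvg_fst. Qed.

Lemma snd_continuous (U V : topologicalType) : continuous (@snd U V).
Proof. by move=> [x y]; exact: cvg_snd. Qed.

Lemma continuous_weighted_sum (R : realType) (T : topologicalType) (I : finType)
    (p : I -> R) (f : I -> T -> R) :
  (forall i, continuous (f i)) -> continuous (fun t => \sum_i p i * f i t).
Proof.
move=> cf; apply: continuous_sumr => i t; apply: cvgM; first exact: cvg_cst.
exact: cf.
Qed.

Lemma continuous_add_sqr_max0 (R : realType) (T : topologicalType)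
    (g e : T -> R) (c : R) : continuous g -> continuous e ->
  continuous (fun t => g t + Num.max 0 (e t - c) ^+ 2).
Proof.
move=> cg ce t; apply: cvgD; first exact: cg.
have cm : {for t, continuous (fun t => Num.max 0 (e t - c))}.
  apply: (@continuous_max _ _ (fun=> 0) (fun t => e t - c)).
    exact: cst_continuous.
  by apply: cvgB; [exact: ce|exact: cvg_cst].
under eq_fun do rewrite expr2.
exact: cvgM.
Qed.

Lemma continuous_pair (T U V : topologicalType) (f : T -> U) (g : T -> V) :
  continuous f -> continuous g -> continuous (fun t => (f t, g t)).
Proof. by move=> cf cg t; apply: cvg_pair; [exact: cf|exact: cg]. Qed.

Lemma continuousD_scale (R : realType) (T : topologicalType) (f g : T -> R)
    (N : R) : continuous f -> continuous g -> continuous (fun t => f t + N * g t).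
Proof.
move=> cf cg t; apply: cvgD; first exact: cf.
by apply: cvgM; [exact: cvg_cst|exact: cg].
Qed.

Lemma compact_ball_dotv (R : realType) (n : nat) (z : 'rV[R]_n) (c : R) :
  compact [set x : 'rV[R]_n | dotv (x - z) (x - z) <= c].
Proof.
pose I i := `[z ord0 i - (1 + `|c|), z ord0 i + (1 + `|c|)]%classic.
pose B := [set x : 'rV[R]_n | forall i, I i (x ord0 i)].
apply: (@subclosed_compact _ _ B).
- rewrite (_ : mkset _ =
    (fun x : 'rV[R]_n => dotv (x - z) (x - z)) @^-1` [set r : R | r <= c])//.
  apply: closed_comp; last exact: closed_le.
  move=> x _; apply: (@continuous_dist _ _ _ id (fun=> z)) => y.
    by move=> A; exact.
  exact: cst_continuous.
- by apply: (@rV_compact R _ I) => i; exact: segment_compact.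
- move=> x /= xc i; rewrite /I /= in_itv/=.
  have := le_trans (coord_sqr_le (x - z) i) xc; rewrite !mxE => h.
  have := ler_norm c => h1; have h2 := normr_ge0 c.
  apply/andP; split; nra.
Qed.

(** * Convex and lower semicontinuous functions *)

Lemma convex_set_segment (R : realType) (M : lmodType R)
    (A : set (convex_lmodType M)) (x y : M) (t : R) :
  convex_set A -> 0 <= t -> t <= 1 -> A x -> A y -> A (x + t *: (y - x)).
Proof.
move=> cA t0 t1 Ax Ay.
have := cA y x (Itv01 t0 t1) (mem_set Ay) (mem_set Ax); rewrite inE.
congr A; rewrite /conv/= scalerBl scale1r scalerBr.
by rewrite [in LHS]addrCA.
Qed.

Lemma lsc_lower_bound (R : realType) (T : topologicalType) (f : T -> \bar R)
    (K : set T) :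
  compact K -> lower_semicontinuous f -> (forall x, -oo < f x)%E ->
  exists b : R, forall x, K x -> (b%:E <= f x)%E.
Proof.
move=> /compact_near_coveringP cK lf fNy.
have [] := cK nat \oo (fun (n : nat) (x : T) => ((- n%:R)%:E < f x)%E) _ _.
- move=> x _; have [a afx] : exists a : R, (a%:E < f x)%E.
    case: (f x) (fNy x) => [r _|_|//]; last by exists 0; rewrite ltry.
    by exists (r - 1); rewrite lte_fin; lra.
  have [V nV Vf] := lf x a afx.
  exists (V, [set n : nat | - a <= n%:R]) => /=.
    by split => //; exact: nbhs_infty_ger.
  move=> [y n] /= [Vy an]; apply: le_lt_trans (Vf y Vy).
  by rewrite lee_fin; lra.
- move=> n _ nK; exists (- n%:R) => x Kx; apply/ltW; apply: nK => //=.
Qed.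

(** A lower bound on the unit ball around x0 propagates along rays: moving from
    x0 towards x by the fraction 1/|x - x0|^2, which stays in the ball when
    |x - x0| >= 1, convexity bounds f(x) from below.  The fraction 1/|x - x0|
    would give a minorant affine in |x - x0|; the squared one avoids square
    roots. *)
Lemma convex_quadratic_minorant (R : realType) (n : nat)
    (f : 'rV[R]_n -> \bar R) (x0 : 'rV[R]_n) (a0 : R) :
  econvex f -> lower_semicontinuous f -> (forall x, -oo < f x)%E ->
  (f x0 <= a0%:E)%E ->
  exists A B : R, 0 <= B /\ forall x a, (f x <= a%:E)%E ->
    A - B * dotv (x - x0) (x - x0) <= a.
Proof.
move=> cf lf fNy fx0.
have [b bf] := lsc_lower_bound (@compact_ball_dotv _ _ x0 1) lf fNy.
have bub x a : dotv (x - x0) (x - x0) <= 1 -> (f x <= a%:E)%E -> b <= a.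
  by move=> x1 fa; rewrite -lee_fin (le_trans _ fa)// bf.
have b0 : b <= a0 by apply: bub fx0; rewrite subrr dotv0l.
exists b, (a0 - b); split; first by rewrite subr_ge0.
move=> x a fa; set q := dotv _ _.
have q0 : 0 <= q by exact: dotv_ge0.
have [q1|q1] := leP q 1; first by have := bub x a q1 fa; nra.
have qi1 : q^-1 <= 1 by rewrite invf_le1 ?ltW//; lra.
have := @convex_set_segment _ _ _ (x0, a0 : R^o) (x, a : R^o) q^-1 cf.
rewrite invr_ge0 => /(_ q0 qi1 fx0 fa) fq.
have q10 : q != 0 by rewrite gt_eqF// (lt_trans ltr01 q1).
have := bub (x0 + q^-1 *: (x - x0)) (a0 + q^-1 * (a - a0)) _ fq.
rewrite [X in X - _]addrC addrK dotvZl dotvZr -/q mulVf// mulr1 => /(_ qi1).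
rewrite -(ler_pM2l (lt_trans ltr01 q1)) mulrDr mulrA mulfV//.
by clear -q1 b0; nra.
Qed.

Lemma lte_dense_EFin (R : realType) (a : R) (y : \bar R) :
  (a%:E < y)%E -> exists2 b : R, a < b & (b%:E < y)%E.
Proof.
case: y => [r|_|//]; last by exists (a + 1); rewrite ?ltry//; lra.
by rewrite lte_fin => ar; exists ((a + r) / 2); rewrite ?lte_fin; lra.
Qed.

Lemma closed_epigraph (R : realType) (n : nat) (f : 'rV[R]_n -> \bar R) :
  lower_semicontinuous f -> closed (epigraph f : set ('rV[R]_n * R)).
Proof.
move=> lf; rewrite -openC openE => -[x a] /= /negP; rewrite -ltNge => afx.
have [b ab bfx] := lte_dense_EFin afx.
have [V nV Vf] := lf x b bfx.
exists (V, [set r | r < b]) => /=; first by split => //; exact: lt_nbhsl.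
move=> [y r] /= [Vy rb]; rewrite /epigraph/= leNgt; apply/negP; rewrite negbK.
by apply: lt_trans (Vf y Vy); rewrite lte_fin.
Qed.

(** * Penalisation *)

(** On the compact set where A <= c, the penalty P is bounded away from 0 and A
    is bounded below, so a large multiple of P wins. *)
Lemma large_penalty_exceeds (R : realType) (T : topologicalType) (K : set T)
    (A P : T -> R) (c : R) :
  compact K -> continuous A -> continuous P -> (forall w, K w -> 0 <= P w) ->
  (forall w, K w -> P w = 0 -> c < A w) ->
  exists N : R, 1 <= N /\ forall w, K w -> c < A w + N * P w.
Proof.
move=> cK cA cP P0 cAP.
pose K' := K `&` (A @^-1` [set r | r <= c]).
have cK' : compact K'.
  rewrite /K'; apply: compact_closedI => //.
  by apply: closed_comp => [x _|]; [exact: cA|exact: closed_le].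
have [K'0|/set0P/negP] := pselect (K' !=set0); last first.
  rewrite negbK => /eqP K'0; exists 1; split => // w Kw; rewrite mul1r.
  have := P0 w Kw; have [Aw|] := leP (A w) c; last lra.
  by have : K' w by []; rewrite K'0.
have [u uK' Pu] := compact_EVT_min K'0 cK' (continuous_subspaceT cP).
have [v vK' Av] := compact_EVT_min K'0 cK' (continuous_subspaceT cA).
move: uK'; rewrite inE => -[Ku /= Auc].
have Pu0 : 0 < P u.
  rewrite lt_neqAle P0// andbT eq_sym; apply/eqP => /(cAP u Ku); lra.
exists (1 + (1 + `|c - A v|) / P u); split.
  by rewrite lerDl divr_ge0 ?ltW.
move=> w Kw; have Pw := P0 w Kw.
have N0 : 0 <= (1 + `|c - A v|) / P u by rewrite divr_ge0 ?ltW.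
have [Aw|] := leP (A w) c; last by nra.
have wK' : w \in K' by rewrite inE; split.
have h1 := Pu w wK'; have h2 := Av w wK'.
have : (1 + `|c - A v|) / P u * P u <= (1 + `|c - A v|) / P u * P w.
  exact: ler_wpM2l.
rewrite divfK ?gt_eqF//; have := ler_norm (c - A v); nra.
Qed.

(** The first-order condition at the left end point of a segment, for a
    function known only up to a quadratic upper bound. *)
Lemma linear_part_ge0 (R : realType) (L Q : R) :
  (forall t, 0 < t -> t <= 1 -> 0 <= t * L + t ^+ 2 * Q) -> 0 <= L.
Proof.
move=> h; rewrite leNgt; apply/negP => L0.
pose t := - L / (- L + 1 + `|Q|).
have Q0 := normr_ge0 Q; have Q1 := ler_norm Q.
have d0 : 0 < - L + 1 + `|Q| by lra.
have t0 : 0 < t by rewrite divr_gt0//; lra.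
have t1 : t <= 1 by rewrite ler_pdivrMr//; lra.
have td : t * (- L + 1 + `|Q|) = - L by rewrite divfK// gt_eqF.
have := h t t0 t1; rewrite expr2 -mulrA -mulrDr pmulr_rge0//; nra.
Qed.

Lemma sqr_max0_ge (R : realType) (u c : R) :
  0 <= c -> 2 * c * u - c ^+ 2 <= Num.max 0 u ^+ 2.
Proof.
move=> c0; have := sqr_ge0 (u - c); have := sqr_ge0 c; rewrite !expr2.
by case: (leP 0 u) => u0 h1 h2; rewrite -subr_ge0; nra.
Qed.

(** The function max(0, .)^2 is differentiable with derivative 2 max(0, .), and
    its derivative is 2-Lipschitz. *)
Lemma sqr_max0_le (R : realType) (u v : R) :
  Num.max 0 v ^+ 2 <= Num.max 0 u ^+ 2 + 2 * Num.max 0 u * (v - u) + (v - u) ^+ 2.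
Proof.
have := sqr_ge0 v; have := sqr_ge0 (v - u); rewrite !expr2.
by case: (leP 0 u) => u0; case: (leP 0 v) => v0 h1 h2; rewrite -subr_ge0; nra.
Qed.

Section penalty_method.
Variables (R : realType) (m k : nat).
Variables (p : 'I_k -> R) (z : 'I_k -> 'rV[R]_m) (rho : R).
Variables (E : set ('rV[R]_m * R)) (Z : set 'rV[R]_m).
Variables (x0 : 'rV[R]_m) (a0 : R) (z0 : 'rV[R]_m).
Hypothesis p_ge0 : forall s, 0 <= p s.

(** Scenario s carries ((x_s, y_s), a_s): a point (x_s, a_s) of the epigraph and
    a copy y_s of x_s that is constrained to Z.  The product topology makes
    Tychonoff's theorem available. *)
Definition state := prod_topology (fun _ : 'I_k => 'rV[R]_m * 'rV[R]_m * R)%type.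

Definition cost (w : state) : R := \sum_s p s * (w s).2.

Definition gap (w : state) : R := \sum_s p s * sqdist (w s).1.1 (w s).1.2.

Definition excess (w : state) : R :=
  \sum_s p s * sqdist (w s).1.1 (z s) - rho ^+ 2.

Definition penalty (w : state) : R := gap w + Num.max 0 (excess w) ^+ 2.

(** A scenario of weight zero is frozen at one admissible point, because the
    objective has no control over it. *)
Definition scenario_set (s : 'I_k) : set ('rV[R]_m * 'rV[R]_m * R) :=
  if 0 < p s then [set t | E (t.1.1, t.2) /\ Z t.1.2] else [set (x0, z0, a0)].

Definition feasible (w : state) := forall s, scenario_set s (w s).

Lemma gap_ge0 (w : state) : 0 <= gap w.
Proof. by apply: sumr_ge0 => s _; rewrite mulr_ge0// sqdist_ge0. Qed.

Lemma penalty_ge0 (w : state) : 0 <= penalty w.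
Proof. by rewrite addr_ge0 ?gap_ge0 ?sqr_ge0. Qed.

Lemma continuous_at_scenario (s : 'I_k) (U : topologicalType)
    (g : 'rV[R]_m * 'rV[R]_m * R -> U) :
  continuous g -> continuous (fun w : state => g (w s)).
Proof.
move=> cg w.
exact: (@continuous_comp state _ U (fun w : state => w s) g w
  (@proj_continuous _ (fun _ : 'I_k => 'rV[R]_m * 'rV[R]_m * R)%type s w)
  (cg (w s))).
Qed.

Lemma continuous_cost : continuous cost.
Proof.
apply: continuous_weighted_sum => s.
exact: (continuous_at_scenario (@snd_continuous _ _)).
Qed.

Lemma continuous_point (s : 'I_k) : continuous (fun w : state => (w s).1.1).
Proof.
apply: (continuous_at_scenario (g := fun t => t.1.1)) => t.
by apply: (@continuous_comp _ _ _ fst fst); exact: fst_continuous.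
Qed.

Lemma continuous_copy (s : 'I_k) : continuous (fun w : state => (w s).1.2).
Proof.
apply: (continuous_at_scenario (g := fun t => t.1.2)) => t.
by apply: (@continuous_comp _ _ _ fst snd);
  [exact: fst_continuous|exact: snd_continuous].
Qed.

Lemma continuous_penalty : continuous penalty.
Proof.
apply: continuous_add_sqr_max0; apply: continuous_weighted_sum => s.
  exact: (continuous_dist (@continuous_point s) (@continuous_copy s)).
apply: (continuous_dist (@continuous_point s)) => ?; exact: cst_continuous.
Qed.

Section duality.
Variables (A : 'I_k -> R) (B : R).
Hypotheses (B_ge0 : 0 <= B) (E_closed : closed E) (Z_closed : closed Z).
Hypothesis E_minorant : forall s x a, E (x, a) -> A s - B * sqdist x (z s) <= a.
Hypothesis E0 : E (x0, a0).
Hypothesis Z0 : Z z0.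

Let q (w : state) : R := \sum_s p s * sqdist (w s).1.1 (z s).

Lemma feasible_minorant (w : state) (s : 'I_k) :
  feasible w -> p s * (A s - B * sqdist (w s).1.1 (z s)) <= p s * (w s).2.
Proof.
move=> /(_ s); rewrite /scenario_set; case: ifPn => [ps [Ew _]|ps _].
  by apply: ler_wpM2l => //; exact: E_minorant.
have -> : p s = 0 by apply/eqP; rewrite eq_le p_ge0 leNgt ps.
by rewrite !mul0r.
Qed.

Lemma weighted_term_le (F : 'I_k -> R) (s : 'I_k) (M : R) :
  (forall j, 0 <= p j * F j) -> \sum_j p j * F j <= M -> 0 < p s ->
  F s <= M / p s.
Proof.
move=> F0 FM ps; rewrite ler_pdivlMr// mulrC; apply: le_trans FM.
by rewrite (bigD1 s)//= lerDl; apply: sumr_ge0.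
Qed.

(** The quadratic minorant bounds the cost below by -B q up to a constant, where
    q is the transport cost of w, while the squared positive part of the excess
    dominates any multiple of q; so q is bounded on sublevel sets, and then so is
    every component of positive weight. *)
Lemma sublevel_bounded (C : R) : exists M1 M2 : R, forall w s,
  feasible w -> cost w + penalty w <= C -> 0 < p s ->
  [/\ sqdist (w s).1.1 (z s) <= M1 / p s,
      sqdist (w s).1.1 (w s).1.2 <= M2 / p s &
      (w s).2 - A s <= M2 / p s].
Proof.
pose SA := \sum_s p s * A s.
pose M1 := C + 2 * (B + 1) * rho ^+ 2 + (B + 1) ^+ 2 - SA.
pose M2 := C - SA + B * M1.
exists M1, M2 => w s dw; rewrite /penalty => wC ps.
have q0 : 0 <= q w by apply: sumr_ge0 => j _; rewrite mulr_ge0// sqdist_ge0.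
have g0 := gap_ge0 w.
have e0 : 0 <= Num.max 0 (excess w) ^+ 2 by exact: sqr_ge0.
have cA : SA - B * q w <= cost w.
  rewrite /SA /q /cost mulr_sumr -sumrB; apply: ler_sum => j _.
  by have := feasible_minorant j dw; rewrite mulrBr [in X in _ - X]mulrCA.
(* slope 2 (B + 1) beats the slope - B of the minorant with room to spare *)
have e1 : 2 * (B + 1) * (q w - rho ^+ 2) - (B + 1) ^+ 2 <=
    Num.max 0 (excess w) ^+ 2.
  by apply: sqr_max0_ge; rewrite addr_ge0.
have qM1 : q w <= M1.
  have Bq := mulr_ge0 B_ge0 q0.
  move: q0 cA e1 wC g0 Bq; rewrite /M1.
  move: (q w) (cost w) (gap w) (Num.max _ _ ^+ 2) => qq cc gg mm.
  by move=> q0 cA e1 wC g0 Bq; lra.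
have BqM1 : B * q w <= B * M1 by exact: ler_wpM2l.
split.
- by apply: (@weighted_term_le (fun j => sqdist (w j).1.1 (z j))) => // j;
    rewrite mulr_ge0// sqdist_ge0.
- apply: (@weighted_term_le (fun j => sqdist (w j).1.1 (w j).1.2)) => // [j|].
    by rewrite mulr_ge0// sqdist_ge0.
  rewrite -/(gap w) /M2; lra.
- have h : (w s).2 - A s + B * sqdist (w s).1.1 (z s) <= M2 / p s.
    apply: (@weighted_term_le
      (fun j => (w j).2 - A j + B * sqdist (w j).1.1 (z j))) => // [j|].
      have := feasible_minorant j dw; rewrite -subr_ge0 -mulrBr.
      by congr (0 <= _ * _); ring.
    rewrite (_ : \sum_j _ = cost w - SA + B * q w); first by rewrite /M2; lra.
    rewrite /cost /SA /q mulr_sumr -sumrB -big_split; apply: eq_bigr => j _ /=.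
    ring.
  apply: le_trans h; rewrite lerDl mulr_ge0// sqdist_ge0//.
Qed.

Lemma coercive_sublevel (C : R) : exists K : set state,
  [/\ compact K, K `<=` feasible &
      forall w, feasible w -> cost w + penalty w <= C -> K w].
Proof.
have [M1 [M2 bnd]] := sublevel_bounded C.
pose X s := [set x : 'rV[R]_m | dotv (x - z s) (x - z s) <= M1 / p s].
pose Y s := [set y : 'rV[R]_m | dotv (y - z s) (y - z s) <=
                              2 * (M2 / p s) + 2 * (M1 / p s)].
pose I s := `[A s - B * (M1 / p s), A s + M2 / p s]%classic.
pose K s : set ('rV[R]_m * 'rV[R]_m * R) :=
  if 0 < p s then (X s `*` Y s `*` I s) `&` scenario_set s
  else [set (x0, z0, a0)].
exists [set w : state | forall s, K s (w s)]; split.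
- apply: tychonoff => s; rewrite /K; case: ifPn => ps; last exact: compact_set1.
  rewrite /scenario_set ps; apply: compact_closedI.
    apply: compact_setX; last exact: segment_compact.
    by apply: compact_setX; exact: compact_ball_dotv.
  apply: (@closedI _ [set t | E (t.1.1, t.2)] [set t | Z t.1.2]).
    apply: (@closed_comp _ _
      (fun t : 'rV[R]_m * 'rV[R]_m * R => (t.1.1, t.2)) E) => // t _.
    apply: continuous_pair; last exact: snd_continuous.
    move=> {}t; by apply: (@continuous_comp _ _ _ fst fst); exact: fst_continuous.
  apply: (@closed_comp _ _ (fun t : 'rV[R]_m * 'rV[R]_m * R => t.1.2) Z) => // t _.
  by apply: (@continuous_comp _ _ _ fst snd);
  [exact: fst_continuous|exact: snd_continuous].
- move=> w Kw s; have := Kw s; rewrite /K.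
  by case: ifPn => [_ []//|/negPf ps]; rewrite /scenario_set ps.
- move=> w dw wC s; have := dw s; rewrite /K.
  case: ifPn => [ps dws|/negPf ps]; last by rewrite /scenario_set ps.
  split => //; move: dws; rewrite /scenario_set ps => -[Ew Zw].
  have [b1 b2 b3] := bnd w s dw wC ps.
  split; first split => //.
    rewrite /Y /=; apply: le_trans (dotv_dist_triangle _ (w s).1.1 _) _.
    apply: lerD; rewrite ler_pM2l//.
    by apply: le_trans b2; rewrite /sqdist -[leRHS]dotvNN opprB.
  rewrite /I /= in_itv/=; apply/andP; split; last by lra.
  have := E_minorant s Ew; apply: le_trans; rewrite lerD2l lerN2.
  exact: ler_wpM2l.
Qed.

Lemma feasible_nonempty : feasible (fun=> (x0, z0, a0)).
Proof. by move=> s; rewrite /scenario_set; case: ifPn. Qed.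

(** Sublevel sets are contained in compact subsets of the feasible set, so the
    extreme value theorem applies on the one that contains a given point. *)
Lemma penalized_min (N : R) : 1 <= N -> exists2 w, feasible w &
  forall w', feasible w' -> cost w + N * penalty w <= cost w' + N * penalty w'.
Proof.
move=> N1; pose H w := cost w + N * penalty w.
pose w0 : state := fun=> (x0, z0, a0).
have H1 w C : H w <= C -> cost w + penalty w <= C.
  apply: le_trans; rewrite /H lerD2l -[leLHS]mul1r ler_wpM2r//.
  exact: penalty_ge0.
have [K [cK Kdom subK]] := coercive_sublevel (H w0).
have Kw0 : K w0 by apply: subK; [exact: feasible_nonempty|exact: H1].
have cH : continuous H.
  exact: (@continuousD_scale _ state cost penalty N
    (@continuous_cost) (@continuous_penalty)).
have [w wK wmin] := compact_EVT_min (ex_intro _ w0 Kw0) cK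
  (continuous_subspaceT cH).
exists w; first by apply: Kdom; rewrite inE in wK.
move=> w' dw'; have [/ltW Hw'|Hw'] := ltP (H w0) (H w').
  by apply: le_trans Hw'; apply: wmin; rewrite inE.
by apply: wmin; rewrite inE; apply: subK => //; exact: H1.
Qed.

(** Where the penalty vanishes, the copies agree with the points and the
    transport budget is respected, so the hypothesis bounds the cost there;
    [large_penalty_exceeds] extends the bound to the sublevel set, and coercivity to all
    feasible states. *)
Lemma penalized_lower_bound (c : R) :
  (forall w, feasible w -> gap w = 0 -> excess w <= 0 -> c < cost w) ->
  exists2 N, 1 <= N & forall w, feasible w -> c < cost w + N * penalty w.
Proof.
move=> cw; have [K [cK Kdom subK]] := coercive_sublevel c.
have [|w Kw Pw|N [N1 NK]] := @large_penalty_exceeds _ _ K cost penalty c cK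
    (@continuous_cost) (@continuous_penalty).
- by move=> w _; exact: penalty_ge0.
- have := gap_ge0 w; have := sqr_ge0 (Num.max 0 (excess w)).
  move: Pw; rewrite /penalty => Pw e0 g0.
  have g00 : gap w = 0 by lra.
  apply: cw => //; first exact: Kdom.
  have : Num.max 0 (excess w) ^+ 2 = 0 by lra.
  by move/eqP; rewrite sqrf_eq0 => /eqP <-; rewrite le_max lexx orbT.
- exists N => // w dw; have [wC|wC] := leP (cost w + penalty w) c.
    exact: NK (subK _ _ _).
  apply: lt_le_trans wC _; rewrite lerD2l -[leLHS]mul1r ler_wpM2r//.
  exact: penalty_ge0.
Qed.

Hypothesis E_segment : forall x a y b t, 0 <= t -> t <= 1 ->
  E (x, a) -> E (y, b) -> E (x + t *: (y - x), a + t * (b - a)).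
Hypothesis Z_segment : forall x y t, 0 <= t -> t <= 1 ->
  Z x -> Z y -> Z (x + t *: (y - x)).

Lemma weighted_sqnorm_line (u d : 'I_k -> 'rV[R]_m) (t : R) :
  \sum_s p s * dotv (u s + t *: d s) (u s + t *: d s) =
  \sum_s p s * dotv (u s) (u s) + 2 * t * (\sum_s p s * dotv (u s) (d s)) +
  t ^+ 2 * (\sum_s p s * dotv (d s) (d s)).
Proof.
rewrite !mulr_sumr -!big_split; apply: eq_bigr => s _ /=.
by rewrite !dotvE (dotvC (d s) (u s)); ring.
Qed.

(** The bounded quantity is the directional derivative of cost + N penalty at w
    towards w'.  Only one-sided quadratic estimates along the segment are used,
    with S bounding the growth of the excess. *)
Lemma penalized_min_gradient (N : R) (w w' : state) :
  0 <= N -> feasible w -> feasible w' ->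
  (forall v, feasible v -> cost w + N * penalty w <= cost v + N * penalty v) ->
  0 <= \sum_s p s * ((w' s).2 - (w s).2)
    + N * (2 * \sum_s p s * dotv ((w s).1.1 - (w s).1.2)
             (((w' s).1.1 - (w s).1.1) - ((w' s).1.2 - (w s).1.2)))
    + 2 * (2 * N * Num.max 0 (excess w)) *
      \sum_s p s * dotv ((w s).1.1 - z s) ((w' s).1.1 - (w s).1.1).
Proof.
move=> N0 dw dw' wmin.
set c1 := \sum_s _; set g1 := \sum_s p s * dotv ((w s).1.1 - (w s).1.2) _.
set a1 := \sum_s p s * dotv ((w s).1.1 - z s) _; set u := Num.max 0 (excess w).
pose g2 := \sum_s p s * dotv (((w' s).1.1 - (w s).1.1) - ((w' s).1.2 - (w s).1.2))
                            (((w' s).1.1 - (w s).1.1) - ((w' s).1.2 - (w s).1.2)).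
pose a2 := \sum_s p s * dotv ((w' s).1.1 - (w s).1.1) ((w' s).1.1 - (w s).1.1).
pose S := 2 * `|a1| + `|a2|.
apply: (@linear_part_ge0 _ _ (N * (g2 + 2 * u * a2 + S ^+ 2))) => t t0 t1.
pose wt : state := fun s => ((w s).1.1 + t *: ((w' s).1.1 - (w s).1.1),
  (w s).1.2 + t *: ((w' s).1.2 - (w s).1.2), (w s).2 + t * ((w' s).2 - (w s).2)).
have dwt : feasible wt.
  move=> s; have := dw s; have := dw' s; rewrite /scenario_set.
  case: ifPn => _.
    move=> [Ew' Zw'] [Ew Zw]; split => /=.
      by apply: E_segment => //; exact: ltW.
    by apply: Z_segment => //; exact: ltW.
  rewrite /wt /= => -> ->.
  by rewrite /= !subrr !scaler0 mulr0 !addr0.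
have costE : cost wt = cost w + t * c1.
  rewrite /cost /c1 mulr_sumr -big_split; apply: eq_bigr => s _ /=; ring.
have gapE : gap wt = gap w + 2 * t * g1 + t ^+ 2 * g2.
  rewrite /gap /sqdist /g1 /g2 -weighted_sqnorm_line; apply: eq_bigr => s _ /=.
  have -> (x y d d' : 'rV[R]_m) :
      (x + t *: d) - (y + t *: d') = (x - y) + t *: (d - d').
    by rewrite scalerBr opprD addrACA.
  by [].
have excessE : excess wt - excess w = 2 * t * a1 + t ^+ 2 * a2.
  have qE : \sum_s p s * sqdist (wt s).1.1 (z s) =
      \sum_s p s * sqdist (w s).1.1 (z s) + 2 * t * a1 + t ^+ 2 * a2.
    rewrite /a1 /a2 -weighted_sqnorm_line; apply: eq_bigr => s _ /=.
    by rewrite /sqdist; congr (_ * dotv _ _); rewrite addrAC.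
  by rewrite /excess qE; ring.
have eS : (excess wt - excess w) ^+ 2 <= t ^+ 2 * S ^+ 2.
  have S0 : 0 <= S by rewrite addr_ge0// mulr_ge0.
  have tS0 : 0 <= t * S by rewrite mulr_ge0// ltW.
  have le_tS : `|2 * t * a1 + t ^+ 2 * a2| <= t * S.
    apply: le_trans (ler_normD _ _) _; rewrite expr2 !normrM (gtr0_norm t0).
    rewrite (ger0_norm (ler0n _ 2)) /S mulrDr [t * (2 * _)]mulrCA -mulrA lerD2l.
    by rewrite -mulrA; apply: ler_wpM2l; [exact: ltW|exact: ler_piMl].
  rewrite excessE -exprMn -[leLHS]ger0_norm ?sqr_ge0// normrX.
  by rewrite ler_sqr.
have maxS := sqr_max0_le (excess w) (excess wt).
have := wmin _ dwt; rewrite /penalty costE gapE -/u.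
have : Num.max 0 (excess wt) ^+ 2 <=
    u ^+ 2 + 2 * u * (2 * t * a1 + t ^+ 2 * a2) + t ^+ 2 * S ^+ 2.
  by apply: le_trans maxS _; rewrite excessE lerD2l -excessE.
move=> /(ler_wpM2l N0).
move: (cost w) (gap w) (Num.max 0 (excess wt) ^+ 2) (S ^+ 2) => cw gw mw SS.
move: (c1) (g1) (a1) (u) (g2) (a2) => c g a v g' a' h1 h2.
lra.
Qed.

(** The dual variables are read off the first-order conditions, one scenario at a
    time: varying (x_s, a_s) alone gives the subgradient inequality that bounds
    the conjugate, and varying y_s alone gives the normal-cone inequality that
    bounds the support function. *)
Lemma penalty_duality (c : R) :
  (forall w, feasible w -> gap w = 0 -> excess w <= 0 -> c < cost w) ->
  exists (lam : R) (xs zeta : 'I_k -> 'rV[R]_m) (v u : 'I_k -> R),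
  let r s := - (2 * lam) *: (xs s - z s) in
  [/\ 0 <= lam,
      forall s, 0 < p s ->
        forall x a, E (x, a) -> dotv (r s - zeta s) x - a <= v s,
      forall s, 0 < p s -> forall y, Z y -> dotv (zeta s) y <= u s &
      \sum_s p s * (v s + u s - dotv (r s) (z s) + lam * sqdist (xs s) (z s))
        + rho ^+ 2 * lam < - c].
Proof.
move=> /penalized_lower_bound[N N1 clt].
have N0 : 0 <= N by lra.
have [w dw wmin] := penalized_min N1.
pose lam := 2 * N * Num.max 0 (excess w).
have lam0 : 0 <= lam by rewrite !mulr_ge0// le_max lexx.
pose xs s := (w s).1.1; pose zeta s := (2 * N) *: ((w s).1.1 - (w s).1.2).
pose r s := - (2 * lam) *: (xs s - z s).
exists lam, xs, zeta, (fun s => dotv (r s - zeta s) (xs s) - (w s).2),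
  (fun s => dotv (zeta s) (w s).1.2).
have grad s x y a : 0 < p s -> E (x, a) -> Z y ->
    0 <= a - (w s).2 + dotv (zeta s) ((x - xs s) - (y - (w s).1.2))
         - dotv (r s) (x - xs s).
  move=> ps Ex Zy.
  pose w' : state := fun j => if j == s then (x, y, a) else w j.
  have dw' : feasible w'.
    move=> j; rewrite /w'; case: eqP => [->|_]; last exact: dw.
    by rewrite /scenario_set ps.
  have := penalized_min_gradient N0 dw dw' wmin.
  rewrite !(bigD1 (P := xpredT) s)//= !big1.
  - rewrite /w' eqxx /= !addr0 -/lam => H; rewrite -(pmulr_rge0 _ ps).
    apply: le_trans H _.
    rewrite /zeta /r !dotvZl -/(xs s).
    by move: (dotv _ _) (dotv _ _) => d1 d2; lra.
  - by move=> j /negPf js; rewrite /w' js subrr dotvC dotv0l mulr0.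
  - by move=> j /negPf js; rewrite /w' js !subrr dotvC dotv0l mulr0.
  - by move=> j /negPf js; rewrite /w' js subrr mulr0.
have wE s : 0 < p s -> E (xs s, (w s).2) /\ Z (w s).1.2.
  by move=> ps; have := dw s; rewrite /scenario_set ps.
split => //.
- move=> s ps x a Ex; have [_ Zw] := wE s ps.
  have := grad s x (w s).1.2 a ps Ex Zw; rewrite -/(r s) !dotvE; lra.
- move=> s ps y Zy; have [Ew _] := wE s ps.
  have := grad s (xs s) y (w s).2 ps Ew Zy; rewrite !dotvE; lra.
- rewrite -/r; have := clt w dw; rewrite -ltrN2; apply: le_lt_trans.
  (* max(0, e) e = max(0, e)^2 turns lambda e into the penalty term *)
  have lamu : lam * excess w = 2 * N * Num.max 0 (excess w) ^+ 2.
    by rewrite /lam; case: (leP 0 (excess w)) => _; rewrite ?expr2; ring.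
  have g0 := gap_ge0 w; have m0 := sqr_ge0 (Num.max 0 (excess w)).
  rewrite (_ : \sum_s _ = - (cost w + 2 * N * gap w + lam * (excess w + rho ^+ 2))).
    by rewrite /penalty mulrDr lamu; nra.
  rewrite /cost /gap /excess addrNK !mulr_sumr -!big_split -sumrN.
  apply: eq_bigr => s _ /=.
  by rewrite /zeta /r /sqdist -/(xs s) !dotvE; ring.
Qed.

End duality.
End penalty_method.

(** * Strong duality for the program *)

(** At r = - 2 lam (x - z) the quadratic term is lam |x - z|^2, also for
    lam = 0: then r = 0 and the term is 0. *)
Lemma quad_over_gradient (R : realType) (n : nat) (lam : R) (x z : 'rV[R]_n) :
  quad_over lam (- (2 * lam) *: (x - z)) = (lam * sqdist x z)%:E.
Proof.
rewrite /quad_over; case: eqP => [->|/eqP lam0].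
  by rewrite mulr0 oppr0 scale0r eqxx mul0r.
rewrite l2norm_sqr dotvZl dotvZr -/(sqdist x z); congr EFin.
by field.
Qed.

Lemma conjugate_le (R : realType) (n : nat) (f : 'rV[R]_n -> \bar R)
    (xi : 'rV[R]_n) (v : R) :
  (forall x, -oo < f x)%E ->
  (forall x a, (f x <= a%:E)%E -> dotv xi x - a <= v) ->
  (conjugate f xi <= v%:E)%E.
Proof.
move=> fNy fv; apply: ge_ereal_sup => _ [x _ <-].
case fx : (f x) (fNy x) => [r| |]//= _; last by rewrite addeNy ?leNye.
by rewrite -EFinB lee_fin; apply: fv; rewrite fx.
Qed.

(** An upper bound c on the worst case over distributions with one atom per
    scenario is also a bound on the program: [penalty_duality] is applied to the
    epigraph of - l(., th) with - c.  The bound v is strict and lam does not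
    depend on tau, so tau lam^2 can be made negligible afterwards. *)
Lemma program_strong_duality (R : realType) (m d k : nat) (Z : set 'rV[R]_m)
    (l : 'rV[R]_m -> 'rV[R]_d -> \bar R) (p : 'I_k -> R)
    (zhat : 'I_k -> 'rV[R]_m) (rho : R) (th : 'rV[R]_d) (c : R) :
  Z !=set0 -> convex_set Z -> closed Z -> (forall s, 0 <= p s) ->
  proper_concave (fun z => l z th) -> econcave (fun z => l z th) ->
  upper_semicontinuous (fun z => l z th) ->
  (forall (x : 'I_k -> 'rV[R]_m) (a : 'I_k -> R),
    (forall s, 0 < p s -> Z (x s) /\ ((a s)%:E <= l (x s) th)%E) ->
    \sum_s p s * sqdist (x s) (zhat s) <= rho ^+ 2 -> \sum_s p s * a s < c) ->
  exists (lam v : R) (r zeta : 'I_k -> 'rV[R]_m),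
    [/\ 0 <= lam, v < c & forall tau,
      (program_objective Z l p zhat rho tau th lam r zeta <=
        (v + tau * lam ^+ 2)%:E)%E].
Proof.
move=> [z0 Zz0] cZ clZ p0 [ly [x0 lx0]] cl usc primal.
pose f x := (- l x th)%E.
have fNy x : (-oo < f x)%E.
  by rewrite /f -[X in (X < _)%E]/(- +oo)%E lteN2.
have [a0 fx0] : exists a0 : R, (f x0 <= a0%:E)%E.
  have := ly x0; rewrite /f; case: (l x0 th) lx0 => [r _ _|//|//].
  by exists (- r).
have [A [B [B0 minor]]] := convex_quadratic_minorant cl usc fNy fx0.
have minor' s x a : epigraph f (x, a) ->
    (A - 2 * B * sqdist (zhat s) x0) - 2 * B * sqdist x (zhat s) <= a.
  move=> /minor; apply: le_trans; rewrite -addrA lerD2l -opprD lerN2.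
  have := dotv_dist_triangle x (zhat s) x0; move=> /(ler_wpM2l B0).
  rewrite /sqdist; move: (dotv _ _) (dotv _ _) (dotv _ _) => t1 t2 t3; lra.
have B20 : 0 <= 2 * B by rewrite mulr_ge0.
have Eseg x a y b t : 0 <= t -> t <= 1 -> epigraph f (x, a) -> epigraph f (y, b) ->
    epigraph f (x + t *: (y - x), a + t * (b - a)).
  by move=> t0 t1 Ex Ey; exact: (@convex_set_segment _ _ _ (x, a) (y, b) t cl).
have Zseg x y t : 0 <= t -> t <= 1 -> Z x -> Z y -> Z (x + t *: (y - x)).
  by move=> t0 t1 Zx Zy; exact: convex_set_segment.
have := @penalty_duality R m k p zhat rho (epigraph f) Z x0 a0 z0 p0
  (fun s => A - 2 * B * sqdist (zhat s) x0) (2 * B) B20 (closed_epigraph usc) clZ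
  minor' fx0 Zz0 Eseg Zseg (- c).
case.
  move=> w dw gw ew; rewrite ltrNl /cost -sumrN.
  under eq_bigr do rewrite -mulrN.
  apply: (primal (fun s => (w s).1.1) (fun s => - (w s).2)); last first.
    by move: ew; rewrite /excess subr_le0.
  move=> s ps; have := dw s; rewrite /scenario_set ps => -[Ew Zw].
  split; last by move: Ew; rewrite /epigraph/= /f leeNl.
  have /eqP := gw; rewrite psumr_eq0 => [/allP/(_ s (mem_index_enum s))|j _]; last first.
    by rewrite mulr_ge0// sqdist_ge0.
  rewrite /= mulf_eq0 gt_eqF//= => /eqP/dotv_eq0/eqP; rewrite subr_eq0.
  by move=> /eqP ->.
move=> lam [xs [zeta [v [u [lam0 conj supp]]]]].
set r := fun s => - (2 * lam) *: (xs s - zhat s).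
rewrite opprK => val.
exists lam, (\sum_s p s * (v s + u s - dotv (r s) (zhat s)
    + lam * sqdist (xs s) (zhat s)) + rho ^+ 2 * lam), r, zeta; split => // tau.
rewrite /program_objective !EFinD -sumEFin; apply: leeD => //; apply: leeD => //.
apply: lee_sum => s _; have [ps|ps] := ltP 0 (p s); last first.
  by rewrite (_ : p s = 0) ?mul0e ?mul0r//; apply/eqP; rewrite eq_le ps p0.
rewrite EFinM; apply: lee_wpmul2l; first by rewrite lee_fin.
rewrite quad_over_gradient !EFinD; apply: leeD => //.
rewrite EFinN; apply: leeB => //.
apply: leeD.
  by apply: conjugate_le => // x a; exact: conj.
by apply: ge_ereal_sup => _ [y Zy <-]; rewrite lee_fin; exact: supp.
Qed.

(** * Finitely supported distributions *)

Section finitely_supported.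
Context d (T : measurableType d) (R : realType) (k : nat).
Variables (p : 'I_k -> R) (x : 'I_k -> T).
Hypotheses (p_ge0 : forall s, 0 <= p s) (p_sum1 : \sum_s p s = 1).

Definition finitely_supported (P : set T -> \bar R) :=
  forall A, measurable A -> P A = (\sum_s (p s)%:E * \d_(x s) A)%E.

Let k_gt0 : (0 < k)%N.
Proof.
case: (posnP k) => // k0; move: p_sum1 => /eqP.
rewrite big1 ?(eq_sym 0) ?oner_eq0// => -[j jk].
by exfalso; move: jk; rewrite k0.
Qed.

Let ord (n : nat) : 'I_k := insubd (Ordinal k_gt0) n.

Let ordE (s : 'I_k) : ord s = s.
Proof. by apply: val_inj; rewrite val_insubd ltn_ord. Qed.

(** Finite sums of measures are indexed by natural numbers; ord n is the n-th
    scenario, with a default value when n >= k. *)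
Definition weighted_diracs : set T -> \bar R :=
  msum (fun n : nat => mscale (NngNum (p_ge0 (ord n))) \d_(x (ord n))) k.

HB.instance Definition _ := Measure.on weighted_diracs.

Lemma weighted_diracsE (A : set T) :
  weighted_diracs A = (\sum_s (p s)%:E * \d_(x s) A)%E.
Proof.
rewrite /weighted_diracs/= /msum/=; apply: eq_bigr => s _.
by rewrite /mscale/= ordE.
Qed.

Lemma integral_weighted_diracs (f : T -> \bar R) :
  measurable_fun setT f -> (forall y, 0 <= f y)%E ->
  (\int[weighted_diracs]_y f y = \sum_s (p s)%:E * f (x s))%E.
Proof.
move=> mf f0; rewrite ge0_integral_measure_sum//; apply: eq_bigr => s _.
by rewrite ge0_integral_mscale//= integral_dirac//= diracT mul1e ordE.
Qed.

Let weighted_diracsT : weighted_diracs setT = 1%E.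
Proof.
rewrite weighted_diracsE; under eq_bigr do rewrite diracT mule1.
by rewrite sumEFin p_sum1.
Qed.

HB.instance Definition _ :=
  Measure_isProbability.Build _ _ _ weighted_diracs weighted_diracsT.

Lemma exists_finitely_supported :
  exists P : probability T R, finitely_supported P.
Proof. by exists weighted_diracs => A _; exact: weighted_diracsE. Qed.

Lemma ge0_integral_finitely_supported (P : {measure set T -> \bar R})
    (f : T -> \bar R) : finitely_supported P ->
  measurable_fun setT f -> (forall y, 0 <= f y)%E ->
  (\int[P]_y f y = \sum_s (p s)%:E * f (x s))%E.
Proof.
move=> PE mf f0; rewrite -integral_weighted_diracs//.
by apply: eq_measure_integral => A mA _; rewrite PE//; exact/esym/weighted_diracsE.
Qed.

(** The integrand may be infinite at atoms of weight zero. *)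
Lemma integral_finitely_supported (P : {measure set T -> \bar R})
    (f : T -> \bar R) (a : 'I_k -> R) : finitely_supported P ->
  measurable_fun setT f -> (forall s, 0 < p s -> f (x s) = (a s)%:E) ->
  (\int[P]_y f y = (\sum_s p s * a s)%:E)%E.
Proof.
move=> PE mf fa; rewrite integralE.
rewrite !ge0_integral_finitely_supported//;
  [|exact: measurable_funeneg|exact: measurable_funepos].
have pw (g : T -> \bar R) (b : 'I_k -> R) :
    (forall s, 0 < p s -> g (x s) = (b s)%:E) ->
    (\sum_s (p s)%:E * g (x s) = (\sum_s p s * b s)%:E)%E.
  move=> gb; rewrite -sumEFin; apply: eq_bigr => s _.
  have [ps|ps] := ltP 0 (p s); first by rewrite gb.
  have -> : p s = 0 by apply/eqP; rewrite eq_le ps p_ge0.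
  by rewrite mul0e mul0r.
rewrite (pw _ (fun s => Num.max (a s) 0)); last first.
  by move=> s ps; rewrite funeposE fa// EFin_max.
rewrite (pw _ (fun s => Num.max (- a s) 0)); last first.
  by move=> s ps; rewrite funenegE fa// EFin_max.
rewrite -EFinB -sumrB; congr EFin; apply: eq_bigr => s _.
rewrite -mulrBr; congr (_ * _).
by case: (leP (a s) 0); case: (leP (- a s) 0); lra.
Qed.

Lemma finitely_supported_full (P : {measure set T -> \bar R}) (A : set T) :
  finitely_supported P -> measurable A ->
  (forall s, 0 < p s -> A (x s)) -> P A = 1%E.
Proof.
move=> PE mA Ax; rewrite PE// -p_sum1 -sumEFin; apply: eq_bigr => s _.
have [ps|ps] := ltP 0 (p s).
  by rewrite diracE mem_set ?mule1//; exact: Ax.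
by have -> : p s = 0 by [apply/eqP; rewrite eq_le ps p_ge0]; rewrite mul0e.
Qed.

End finitely_supported.

(** * Borel measurability on row vectors *)

Lemma borel_open (R : realType) (n : nat) (A : set 'rV[R]_n) :
  open A -> measurable (A : set (borelRV R n)).
Proof. by move=> oA; exact: sub_sigma_algebra. Qed.

Lemma borel_closed (R : realType) (n : nat) (A : set 'rV[R]_n) :
  closed A -> measurable (A : set (borelRV R n)).
Proof.
move=> cA; rewrite -(setCK A); apply: measurableC.
by apply: borel_open; exact: closed_openC.
Qed.

Lemma borel_lsc (R : realType) (n : nat) (f : 'rV[R]_n -> \bar R) :
  lower_semicontinuous f -> measurable_fun setT (f : borelRV R n -> \bar R).
Proof.
move=> lf; apply: (measurability _ (ErealGenOInfty.measurableE R)).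
move=> /= _ [_ [a ->]] <-; apply: measurableI => //; apply: borel_open.
by rewrite preimage_itvoy; move/lower_semicontinuousP : lf; exact.
Qed.

Lemma borel_usc (R : realType) (n : nat) (f : 'rV[R]_n -> \bar R) :
  upper_semicontinuous f -> measurable_fun setT (f : borelRV R n -> \bar R).
Proof.
move=> uf; rewrite (_ : f = (fun x => - - f x)%E); last first.
  by apply/funext => x; rewrite oppeK.
exact: measurableT_comp (borel_lsc uf).
Qed.

Lemma borel_continuous (R : realType) (n : nat) (f : 'rV[R]_n -> R) :
  continuous f -> measurable_fun setT (f : borelRV R n -> R).
Proof.
move=> cf; apply/measurable_EFinP; apply: borel_lsc.
apply/lower_semicontinuousP => a.
rewrite (_ : [set x | _] = f @^-1` [set r | a < r])//.
apply: open_comp => [x _|]; [exact: cf|exact: open_gt].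
Qed.

Lemma measurable_sqdist (R : realType) (n : nat) d (T : measurableType d)
    (f g : T -> borelRV R n) :
  measurable_fun setT f -> measurable_fun setT g ->
  measurable_fun setT (fun t => sqdist (f t : 'rV[R]_n) (g t)).
Proof.
move=> mf mg; rewrite /sqdist /dotv.
apply: measurable_sum => i; under eq_fun do rewrite !mxE.
have mc (h : T -> borelRV R n) : measurable_fun setT h ->
    measurable_fun setT (fun t => (h t : 'rV[R]_n) ord0 i).
  move=> mh; apply: (measurableT_comp
    (f := (fun y : borelRV R n => (y : 'rV[R]_n) ord0 i))) => //.
  by apply: borel_continuous; exact: coord_continuous.
by apply: measurable_funM; apply: measurable_funB; exact: mc.
Qed.

(** * The Wasserstein ball *)

Lemma measurable_transport_cost (R : realType) (n : nat) :
  measurable_fun setT (fun t : borelRV R n * borelRV R n =>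
    sqdist (t.1 : 'rV[R]_n) (t.2 : 'rV[R]_n)).
Proof. by apply: measurable_sqdist; [exact: measurable_fst|exact: measurable_snd]. Qed.

Lemma W2_leE (R : realType) (n : nat) (Q P : probability (borelRV R n) R)
    (rho : R) : 0 <= rho ->
  (W2 Q P <= rho%:E)%E =
  (ereal_inf [set \int[pi]_x (sqdist (x.1 : 'rV[R]_n) x.2)%:E
             | pi in [set pi | is_coupling Q P pi]] <= (rho ^+ 2)%:E)%E.
Proof.
move=> rho0; rewrite /W2.
under eq_imagel do under eq_integral do rewrite l2norm_sqr -/(sqdist _ _).
have -> : rho%:E = sqrte (rho ^+ 2)%:E by rewrite /= sqrtr_sqr ger0_norm.
by rewrite lee_sqrt// lee_fin sqr_ge0.
Qed.

(** Sending all the mass of atom z s to x s is a coupling, whose cost bounds the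
    Wasserstein distance. *)
Lemma W2_ball_finitely_supported (R : realType) (n k : nat) (p : 'I_k -> R)
    (x z : 'I_k -> 'rV[R]_n) (Z : set 'rV[R]_n)
    (P : probability (borelRV R n) R) (rho : R) :
  (forall s, 0 <= p s) -> \sum_s p s = 1 -> 0 <= rho -> closed Z ->
  is_discrete_law p z P -> (forall s, 0 < p s -> Z (x s)) ->
  \sum_s p s * sqdist (x s) (z s) <= rho ^+ 2 ->
  exists2 Q, W2_ball Z P rho Q & is_discrete_law p x Q.
Proof.
move=> p0 p1 rho0 cZ Pz Zx cost_le.
have [Q Qx] := @exists_finitely_supported _ (borelRV R n) R k p x p0 p1.
exists Q => //; split.
- exact: (finitely_supported_full p0 p1 Qx (borel_closed cZ) Zx).
- rewrite (integral_finitely_supported p0 p1 (a := fun s => l2norm (x s) ^+ 2) Qx)//.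
    by rewrite ltry.
  apply/measurable_EFinP; apply: borel_continuous => y.
  under eq_fun do rewrite l2norm_sqr.
  by apply: (@continuous_dotv _ _ _ id id) => t A; exact.
rewrite W2_leE//.
have [pi pixz] := @exists_finitely_supported _ (borelRV R n * borelRV R n)%type
  R k p (fun s => (x s, z s)) p0 p1.
apply: ge_ereal_inf; exists (\sum_s p s * sqdist (x s) (z s))%:E; last first.
  by rewrite lee_fin.
exists pi.
  split => A mA.
    rewrite pixz; last exact: measurableX.
    by rewrite Qx//; apply: eq_bigr => s _; rewrite !diracE in_setX in_setT andbT.
  rewrite pixz; last exact: measurableX.
  by rewrite Pz//; apply: eq_bigr => s _; rewrite !diracE in_setX in_setT.
rewrite (integral_finitely_supported p0 p1 (a := fun s => sqdist (x s) (z s)) pixz)//.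
apply/measurable_EFinP; exact: measurable_transport_cost.
Qed.

(** The least of the B s over the scenarios s of positive weight located at y,
    and M if there is none.  Several scenarios may sit at the same point with
    different values, so the bound B s is turned into a function of the location
    alone before it is integrated; the minimum is written with indicator
    functions of points to make it measurable. *)
Definition atom_potential (R : realType) (n k : nat) (p : 'I_k -> R)
    (z : 'I_k -> 'rV[R]_n) (B : 'I_k -> R) (M : R) (y : borelRV R n) : R :=
  \big[Num.min/M]_(j < k) (M - (if 0 < p j then M - B j else 0) * \1_[set z j] y).

Lemma measurable_atom_potential (R : realType) (n k : nat) (p : 'I_k -> R)
    (z : 'I_k -> 'rV[R]_n) (B : 'I_k -> R) (M : R) :
  measurable_fun setT (atom_potential p z B M).
Proof.
rewrite /atom_potential; elim: (index_enum _) => [|j s IH].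
  by under eq_fun do rewrite big_nil; exact: measurable_cst.
under eq_fun do rewrite big_cons; apply: measurable_minr => //.
apply: measurable_funB => //; apply: measurable_funM => //.
apply: measurable_indic; apply: borel_closed.
by apply: accessible_closed_set1; apply: hausdorff_accessible; exact: norm_hausdorff.
Qed.

Lemma atom_potential_le (R : realType) (n k : nat) (p : 'I_k -> R)
    (z : 'I_k -> 'rV[R]_n) (B : 'I_k -> R) (M : R) (s : 'I_k) :
  0 < p s -> atom_potential p z B M (z s) <= B s.
Proof.
move=> ps; rewrite /atom_potential (bigD1 s)//= ge_min ps indicE mem_set//.
by rewrite mulr1 subKr lexx.
Qed.

(** The minimum is one of the competing values. *)
Lemma atom_potential_ge (R : realType) (n k : nat) (p : 'I_k -> R)
    (z : 'I_k -> 'rV[R]_n) (B : 'I_k -> R) (M : R) (C : R -> Prop) (s : 'I_k) :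
  (forall j, 0 < p j -> z j = z s -> C (B j)) -> C M ->
  C (atom_potential p z B M (z s)).
Proof.
move=> CB CM; rewrite /atom_potential; apply: (big_ind C) => //.
  by move=> u v Cu Cv; case: leP.
move=> j _; case: ifPn => pj; last by rewrite mul0r subr0.
rewrite indicE; have [zj|zj] := pselect (z s = z j).
  by rewrite mem_set// mulr1 subKr; apply: CB.
by rewrite memNset ?mulr0 ?subr0.
Qed.

(** Monotonicity without integrability: positive and negative parts are compared
    separately. *)
Lemma le_integral_ae (R : realType) d (T : measurableType d)
    (mu : {measure set T -> \bar R}) (f g : T -> \bar R) :
  measurable_fun setT f -> measurable_fun setT g ->
  {ae mu, forall x, (f x <= g x)%E} -> (\int[mu]_x f x <= \int[mu]_x g x)%E.
Proof.
move=> mf mg fg; rewrite integralE [leRHS]integralE; apply: leeB.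
  apply: ae_ge0_le_integral => //;
    [exact: measurable_funepos|exact: measurable_funepos|].
  apply: filterS fg => x fg _; rewrite !funeposE; exact: le_max2.
apply: ae_ge0_le_integral => //;
  [exact: measurable_funeneg|exact: measurable_funeneg|].
apply: filterS fg => x fg _; rewrite !funenegE; apply: le_max2 => //.
by rewrite leeN2.
Qed.

Lemma integral_image_measure (R : realType) d1 d2 (X : measurableType d1)
    (Y : measurableType d2) (phi : X -> Y) (mu : {measure set X -> \bar R})
    (nu : {measure set Y -> \bar R}) (f : Y -> \bar R) :
  measurable_fun setT phi ->
  (forall A, measurable A -> nu A = mu (phi @^-1` A)) ->
  measurable_fun setT f -> (\int[nu]_y f y = \int[mu]_x f (phi x))%E.
Proof.
move=> mphi nuE mf.
have ge0 (h : Y -> \bar R) : measurable_fun setT h -> (forall y, 0 <= h y)%E ->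
    (\int[nu]_y h y = \int[mu]_x h (phi x))%E.
  move=> mh h0; rewrite -(@ge0_integral_pushforward _ _ _ _ R phi mphi mu setT h)//.
  by apply: eq_measure_integral => A mA _; rewrite nuE.
rewrite integralE [RHS]integralE !ge0//;
  [|exact: measurable_funeneg|exact: measurable_funepos].
by congr (_ - _)%E; apply: eq_integral => x _; rewrite ?funeposE ?funenegE.
Qed.

(** Under a coupling of Q and P the first marginal lives on Z and the second one
    on the atoms z s, so g(t.1) <= lam |t.1 - t.2|^2 + b(t.2) almost surely, with
    b the [atom_potential] of B.  A coupling whose
    cost is within e / (lam + 1) of rho^2 loses at most e. *)
Lemma weak_duality_integral (R : realType) (n k : nat) (p : 'I_k -> R)
    (z : 'I_k -> 'rV[R]_n) (Z : set 'rV[R]_n)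
    (P Q : probability (borelRV R n) R) (rho lam : R)
    (g : 'rV[R]_n -> \bar R) (B : 'I_k -> R) :
  (forall s, 0 <= p s) -> \sum_s p s = 1 -> 0 <= rho -> 0 <= lam -> closed Z ->
  is_discrete_law p z P -> upper_semicontinuous g ->
  (forall s, 0 < p s -> forall y, Z y ->
    (g y <= (B s + lam * sqdist y (z s))%:E)%E) ->
  W2_ball Z P rho Q ->
  (\int[Q]_y g y <= (\sum_s p s * B s + lam * rho ^+ 2)%:E)%E.
Proof.
move=> p0 p1 rho0 lam0 cZ Pz ug gB [QZ _]; rewrite W2_leE// => W2rho.
apply/lee_addgt0Pr => e e0; rewrite -EFinD.
have el0 : 0 < e / (lam + 1) by rewrite divr_gt0//; lra.
have [_ [pi [piQ piP] <-] cost_lt] : exists2 c,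
    [set \int[pi]_x (sqdist (x.1 : 'rV[R]_n) x.2)%:E
      | pi in [set pi | is_coupling Q P pi]]%E c &
    (c < (rho ^+ 2 + e / (lam + 1))%:E)%E.
  by apply: ereal_inf_lt; apply: le_lt_trans W2rho _; rewrite lte_fin ltrDl.
pose M := \sum_s `|B s|; pose b := atom_potential p z B M.
pose D (t : borelRV R n * borelRV R n) := sqdist (t.1 : 'rV[R]_n) (t.2 : 'rV[R]_n).
have mD : measurable_fun setT D by exact: measurable_transport_cost.
have mb : measurable_fun setT b by exact: measurable_atom_potential.
have mg : measurable_fun setT (g : borelRV R n -> \bar R) by exact: borel_usc.
have D0 t : 0 <= D t by exact: sqdist_ge0.
have BM s : B s <= M.
  apply: le_trans (ler_norm _) _.
  by rewrite /M (bigD1 s)//= lerDl; apply: sumr_ge0.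
pose F : set (borelRV R n) := \bigcup_(s in [set s | 0 < p s]) [set z s].
have mF : measurable F.
  apply: fin_bigcup_measurable => [|s _]; first exact: finite_finset.
  apply: borel_closed; apply: accessible_closed_set1.
  by apply: hausdorff_accessible; exact: norm_hausdorff.
have mZ := borel_closed cZ.
have PF : P F = 1%E by apply: (finitely_supported_full p0 p1 Pz mF) => s ps; exists s.
have aeZ : {ae pi, forall t, Z t.1}.
  exists (~` (Z : set (borelRV R n)) `*` setT); split.
  - by apply: measurableX => //; exact: measurableC.
  - by rewrite piQ; [rewrite probability_setC// QZ subee|exact: measurableC].
  - by move=> [t1 t2] /=.
have aeF : {ae pi, forall t, F t.2}.
  exists (setT `*` ~` F); split.
  - by apply: measurableX => //; exact: measurableC.
  - by rewrite piP; [rewrite probability_setC// PF subee|exact: measurableC].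
  - by move=> [t1 t2] /=.
have -> : (\int[Q]_y g y = \int[pi]_t g t.1)%E.
  apply: (integral_image_measure measurable_fst) => // A mA.
  transitivity (pi (A `*` setT)); first exact/esym/piQ.
  by congr (pi _); apply/seteqP; split => [[t1 t2] []|[t1 t2]].
have Pb (f : borelRV R n -> \bar R) : measurable_fun setT f ->
    (\int[P]_y f y = \int[pi]_t f t.2)%E.
  move=> mf; apply: (integral_image_measure measurable_snd) => // A mA.
  transitivity (pi (setT `*` A)); first exact/esym/piP.
  by congr (pi _); apply/seteqP; split => [[t1 t2] []|[t1 t2]].
apply: (@le_trans _ _ (\int[pi]_t ((lam * D t)%:E + (b t.2)%:E)))%E.
  apply: le_integral_ae.
  - exact: measurableT_comp mg measurable_fst.
  - apply: emeasurable_funD; apply/measurable_EFinP.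
      by apply: measurable_funM.
    exact: measurableT_comp mb measurable_snd.
  - apply: (filterS2 (ae_filter_ringOfSetsType pi) _ aeZ aeF).
    move=> -[y1 y2] /= Zy1 [s /= ps y2z].
    rewrite y2z /D /= addeC -EFinD.
    apply: (@atom_potential_ge R n k p z B M
      (fun v => (g y1 <= (v + lam * sqdist (y1 : 'rV[R]_n) (z s))%:E)%E)).
      by move=> j pj <-; exact: gB.
    by apply: le_trans (gB s ps y1 Zy1) _; rewrite lee_fin lerD2r.
have iD : pi.-integrable setT (EFin \o D).
  apply/integrableP; split; first exact/measurable_EFinP.
  under eq_integral do rewrite /= ger0_norm//.
  by apply: lt_trans cost_lt _; rewrite ltry.
have iDl : pi.-integrable setT (fun t => (lam * D t)%:E).
  by under eq_fun do rewrite EFinM; exact: integrableZl.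
have ib : pi.-integrable setT (fun t => (b t.2)%:E).
  apply/integrableP; split.
    by apply/measurable_EFinP; exact: measurableT_comp mb measurable_snd.
  rewrite -(Pb (fun y => `|(b y)%:E|%E)).
    rewrite (integral_finitely_supported p0 p1 (a := fun s => `|b (z s)|) Pz)//.
      by rewrite ltry.
    by apply: measurableT_comp => //; exact/measurable_EFinP.
  by apply: measurableT_comp => //; exact/measurable_EFinP.
rewrite integralD//.
have -> : (\int[pi]_t (b t.2)%:E = (\sum_s p s * b (z s))%:E)%E.
  rewrite -(Pb (fun y => (b y)%:E)); last exact/measurable_EFinP.
  rewrite (integral_finitely_supported p0 p1 (a := fun s => b (z s)) Pz)//.
  exact/measurable_EFinP.
rewrite [X in (X + _)%E](_ : _ = (lam%:E * \int[pi]_t (D t)%:E)%E); last first.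
  by under eq_integral do rewrite EFinM; rewrite integralZl.
rewrite addeC -addrA EFinD; apply: leeD.
  rewrite lee_fin; apply: ler_sum => s _; have [ps|ps] := ltP 0 (p s).
    by apply: ler_wpM2l => //; exact: atom_potential_le.
  by have -> : p s = 0 by [apply/eqP; rewrite eq_le ps p0]; rewrite !mul0r.
apply: (@le_trans _ _ (lam%:E * (rho ^+ 2 + e / (lam + 1))%:E)%E).
  by apply: lee_wpmul2l; [rewrite lee_fin|exact: ltW].
rewrite -EFinM lee_fin mulrDr lerD2l mulrCA ler_piMr//; first exact: ltW.
by rewrite ler_pdivrMr ?mul1r; lra.
Qed.

(** Each admissible choice of atoms defines a distribution in the ball. *)
Lemma worst_case_lt (R : realType) (m k : nat) (Z : set 'rV[R]_m)
    (g : 'rV[R]_m -> \bar R) (p : 'I_k -> R) (zhat : 'I_k -> 'rV[R]_m)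
    (P : probability (borelRV R m) R) (rho c : R) :
  (forall s, 0 <= p s) -> \sum_s p s = 1 -> 0 <= rho -> closed Z ->
  is_discrete_law p zhat P -> (forall z, g z < +oo)%E ->
  upper_semicontinuous g ->
  (ereal_sup [set \int[Q]_z g z | Q in W2_ball Z P rho] < c%:E)%E ->
  forall (x : 'I_k -> 'rV[R]_m) (a : 'I_k -> R),
    (forall s, 0 < p s -> Z (x s) /\ ((a s)%:E <= g (x s))%E) ->
    \sum_s p s * sqdist (x s) (zhat s) <= rho ^+ 2 -> \sum_s p s * a s < c.
Proof.
move=> p0 p1 rho0 cZ Pz gy ug sup_lt x a xa cost_le.
have [Q QB Qx] := W2_ball_finitely_supported p0 p1 rho0 cZ Pz
  (fun s ps => proj1 (xa s ps)) cost_le.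
rewrite -lte_fin; apply: le_lt_trans sup_lt.
apply: le_ereal_sup_tmp; exists (\int[Q]_z g z)%E; first by exists Q.
have gE s : 0 < p s -> g (x s) = (fine (g (x s)))%:E.
  move=> ps; rewrite fineK// fin_numE -ltey gy andbT -ltNye.
  by apply: lt_le_trans (proj2 (xa s ps)); rewrite ltNyr.
rewrite (integral_finitely_supported p0 p1 (a := fun s => fine (g (x s))) Qx)//.
  rewrite lee_fin; apply: ler_sum => s _; have [ps|ps] := ltP 0 (p s).
    by apply: ler_wpM2l => //; rewrite -lee_fin -gE//; exact: (proj2 (xa s ps)).
  by have -> : p s = 0 by [apply/eqP; rewrite eq_le ps p0]; rewrite !mul0r.
exact: borel_usc.
Qed.

(** * Weak duality for the program *)

(** The Fenchel-Young inequality for lam |.|^2. *)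
Lemma quad_over_ge (R : realType) (n : nat) (lam : R) (r w : 'rV[R]_n) :
  0 <= lam -> ((dotv r w - lam * dotv w w)%:E <= quad_over lam r)%E.
Proof.
rewrite /quad_over le_eqVlt => /predU1P[<-|lam0].
  by rewrite eqxx; case: eqP => [->|_]; rewrite ?leey// dotv0l mul0r subr0.
rewrite gt_eqF// lee_fin l2norm_sqr -subr_ge0.
have := dotv_ge0 (r - (2 * lam) *: w); rewrite !dotvE (dotvC w r) => h.
have il0 : 0 <= (4 * lam)^-1 by rewrite invr_ge0; lra.
have := mulr_ge0 il0 h; congr (_ <= _).
by move: (dotv _ _) (dotv _ _) (dotv _ _) => t1 t2 t3; field; rewrite gt_eqF.
Qed.

(** The function beta collects the brackets of the objective.  They never equal
    -oo, so that either one with positive weight is +oo and there is nothing to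
    prove, or all those with positive weight are real. *)
Lemma weak_duality_program (R : realType) (m d k : nat) (Z : set 'rV[R]_m)
    (l : 'rV[R]_m -> 'rV[R]_d -> \bar R) (p : 'I_k -> R)
    (zhat : 'I_k -> 'rV[R]_m) (P Q : probability (borelRV R m) R)
    (rho tau lam : R) (th : 'rV[R]_d) (r zeta : 'I_k -> 'rV[R]_m) :
  (forall s, 0 <= p s) -> \sum_s p s = 1 -> 0 <= rho -> 0 <= tau -> 0 <= lam ->
  Z !=set0 -> closed Z -> is_discrete_law p zhat P ->
  proper_concave (fun z => l z th) -> upper_semicontinuous (fun z => l z th) ->
  W2_ball Z P rho Q ->
  (\int[Q]_z l z th <= program_objective Z l p zhat rho tau th lam r zeta)%E.
Proof.
move=> p0 p1 rho0 tau0 lam0 [z0 Zz0] cZ Pz [ly [x0 lx0]] ul QB.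
pose beta s := (conjugate (fun z => - l z th) (r s - zeta s)
  + support_fun Z (zeta s) - (dotv (r s) (zhat s))%:E + quad_over lam (r s))%E.
rewrite -[leRHS]/(\sum_s (p s)%:E * beta s + (rho ^+ 2 * lam)%:E
  + (tau * lam ^+ 2)%:E)%E.
have conj_ge s y (a : R) : (a%:E <= l y th)%E ->
    ((dotv (r s - zeta s) y + a)%:E <=
      conjugate (fun z => - l z th) (r s - zeta s))%E.
  move=> al; apply: (@le_trans _ _ ((dotv (r s - zeta s) y)%:E - - l y th)%E).
    by rewrite EFinD oppeK leeD2l.
  by apply: ereal_sup_ubound; exists y.
have beta_ge s y (a : R) : Z y -> (a%:E <= l y th)%E ->
    ((a - lam * sqdist y (zhat s))%:E <= beta s)%E.
  move=> Zy al.
  apply: (@le_trans _ _ ((dotv (r s - zeta s) y + a)%:E + (dotv (zeta s) y)%:E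
    - (dotv (r s) (zhat s))%:E
    + (dotv (r s) (zhat s - y) - lam * dotv (zhat s - y) (zhat s - y))%:E)%E).
    rewrite -!EFinD lee_fin /sqdist -(dotvNN (y - zhat s)) opprB !dotvE; lra.
  apply: leeD; last exact: quad_over_ge.
  apply: leeB => //; apply: leeD; first exact: conj_ge.
  by apply: ereal_sup_ubound; exists y.
have betaNy s : beta s != -oo%E.
  have [a0 a0l] : exists a0 : R, (a0%:E <= l x0 th)%E.
    by case: (l x0 th) lx0 (ly x0) => [a _ _|//|//]; exists a.
  have cNy := conj_ge s x0 a0 a0l.
  have sNy : ((dotv (zeta s) z0)%:E <= support_fun Z (zeta s))%E.
    by apply: ereal_sup_ubound; exists z0.
  have qNy := quad_over_ge (r s) 0 lam0.
  have bNy : ((dotv (r s - zeta s) x0 + a0)%:E + (dotv (zeta s) z0)%:E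
      - (dotv (r s) (zhat s))%:E
      + (dotv (r s) 0 - lam * dotv (0 : 'rV[R]_m) 0)%:E <= beta s)%E.
    rewrite /beta; apply: leeD; last exact: qNy.
    by apply: leeB => //; apply: leeD.
  by rewrite -ltNye; apply: lt_le_trans bNy; rewrite ltNyr.
have [[s ps sy]|fin] := pselect (exists2 s, 0 < p s & beta s = +oo%E).
  rewrite (_ : (\sum_s _)%E = +oo%E) ?addye ?leey//.
  apply/eqP; rewrite esum_eqy => [|j _].
    by apply/existsP; exists s; rewrite /= sy gt0_muley.
  have [pj|pj] := ltP 0 (p j); last first.
    by have -> : p j = 0 by [apply/eqP; rewrite eq_le pj p0]; rewrite mul0e.
  by case: (beta j) (betaNy j) => [b|_|//] //; rewrite gt0_muley.
have betaE s : 0 < p s -> beta s = (fine (beta s))%:E.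
  move=> ps; rewrite fineK// fin_numE betaNy/=; apply/eqP => sy.
  by apply: fin; exists s.
rewrite (_ : (\sum_s _)%E = (\sum_s p s * fine (beta s))%:E); last first.
  rewrite -sumEFin; apply: eq_bigr => s _; have [ps|ps] := ltP 0 (p s).
    by rewrite betaE.
  by have -> : p s = 0 by [apply/eqP; rewrite eq_le ps p0]; rewrite mul0e mul0r.
apply: (@le_trans _ _ (\sum_s p s * fine (beta s) + lam * rho ^+ 2)%:E).
  apply: (weak_duality_integral p0 p1 rho0 lam0 cZ Pz ul) QB => s ps y Zy.
  case: (l y th) (ly y) (@beta_ge s y) => [a _ bg|//|_ _]; last exact: leNye.
  by have := bg a Zy (lexx _); rewrite (betaE s ps) !lee_fin lerBlDr.
rewrite -!EFinD lee_fin [lam * _]mulrC lerDl mulr_ge0// sqr_ge0//.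
Qed.

(** * The limit of the program values *)

Lemma cvge_right_of_bounds (R : realType) (J : R -> \bar R) (V : \bar R) :
  (forall tau, 0 < tau -> (V <= J tau)%E) ->
  (forall c : R, (V < c%:E)%E -> \forall tau \near 0^'+, (J tau < c%:E)%E) ->
  J tau @[tau --> 0^'+] --> V.
Proof.
move=> lb ub; case: V lb ub => [v| |] lb ub.
- have Jlb : \forall tau \near 0^'+, (v%:E <= J tau)%E.
    by near=> tau; apply: lb; near: tau; exact: nbhs_right_gt.
  apply/fine_cvgP; split.
    have v1 : (v%:E < (v + 1)%:E)%E by rewrite lte_fin ltrDl.
    apply: filterS2 Jlb (ub _ v1) => tau vJ Jv.
    rewrite fin_numElt (lt_le_trans _ vJ) ?ltNyr//=.
    by rewrite (lt_trans Jv)// ltry.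
  apply/cvgrPdist_lt => e e0.
  have ve : (v%:E < (v + e)%:E)%E by rewrite lte_fin ltrDl.
  apply: filterS2 Jlb (ub _ ve) => tau /=.
  case: (J tau) => [j|//|//]; rewrite lee_fin lte_fin /= => vj je.
  by rewrite distrC ger0_norm ?subr_ge0// ltrBlDl.
- apply/cvgeyPge => A; near=> tau; apply: (@le_trans _ _ +oo%E); first exact: leey.
  by apply: lb; near: tau; exact: nbhs_right_gt.
- by apply/cvgeNyPlt => c; apply: ub; rewrite ltNyr.
Unshelve. all: by end_near.
Qed.

Theorem mainTheorem3 (R : realType) (m d k : nat)
  (Z : set 'rV[R]_m) (Theta : set 'rV[R]_d)
  (l : 'rV[R]_m -> 'rV[R]_d -> \bar R)
  (phat : 'I_k -> 'rV[R]_d -> R) (zhat : 'I_k -> 'rV[R]_d -> 'rV[R]_m)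
  (Phat : 'rV[R]_d -> probability (borelRV R m) R)
  (rho : R) (theta_t : 'rV[R]_d)
  (Z_neq0 : Z !=set0) (Z_convex : convex_set Z) (Z_closed : closed Z)
  (phat_ge0 : forall th, Theta th -> forall s, 0 <= phat s th)
  (phat_sum1 : forall th, Theta th -> \sum_(s < k) phat s th = 1)
  (zhat_Z : forall th, Theta th -> forall s, Z (zhat s th))
  (Phat_law : forall th, Theta th ->
     is_discrete_law (fun s => phat s th) (fun s => zhat s th) (Phat th))
  (l_convex : forall z, Z z -> econvex (l z))
  (l_proper : forall th, Theta th -> proper_concave (fun z => l z th))
  (l_concave : forall th, Theta th -> econcave (fun z => l z th))
  (l_usc : forall th, Theta th -> upper_semicontinuous (fun z => l z th))
  (rho_ge0 : 0 <= rho) (theta_tP : Theta theta_t) :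
  let V := dro_value Z Theta l (Phat theta_t) rho in
  let J := program_value Z Theta l
             (fun s => phat s theta_t) (fun s => zhat s theta_t) rho in
  (forall tau : R, 0 < tau -> (V <= J tau)%E) /\
  J tau @[tau --> 0^'+] --> V.
Proof.
move=> V J.
have p0 := phat_ge0 _ theta_tP; have p1 := phat_sum1 _ theta_tP.
have Pz := Phat_law _ theta_tP.
have VJ tau : 0 < tau -> (V <= J tau)%E.
  move=> tau0; apply: le_ereal_inf_tmp => _ [th [lam [r [zeta [thP lam0 ->]]]]].
  apply: ge_ereal_inf; exists (ereal_sup [set (\int[Q]_z l z th)%E
    | Q in W2_ball Z (Phat theta_t) rho]); first by exists th.
  apply: ge_ereal_sup => _ [Q QB <-].
  apply: (weak_duality_program _ _ p0 p1 rho_ge0 _ lam0 Z_neq0 Z_closed Pz) QB.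
  - exact: ltW.
  - exact: l_proper.
  - exact: l_usc.
split => //; apply: cvge_right_of_bounds => // c /ereal_inf_lt[_ [th thP <-] Vc].
have primal := worst_case_lt p0 p1 rho_ge0 Z_closed Pz
  (proj1 (l_proper _ thP)) (l_usc _ thP) Vc.
have [lam [v [r [zeta [lam0 vc obj]]]]] := program_strong_duality Z_neq0 Z_convex
  Z_closed p0 (l_proper _ thP) (l_concave _ thP) (l_usc _ thP) primal.
have e0 : 0 < (c - v) / (lam ^+ 2 + 1).
  by rewrite divr_gt0 ?subr_gt0// ltr_wpDl// sqr_ge0.
near=> tau.
have tau0 : 0 < tau by near: tau; exact: nbhs_right_gt.
have taue : tau < (c - v) / (lam ^+ 2 + 1) by near: tau; exact: nbhs_right_lt.
apply: (@le_lt_trans _ _ (v + tau * lam ^+ 2)%:E).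
  apply: ge_ereal_inf; eexists; last exact: (obj tau).
  by exists th, lam, r, zeta.
rewrite lte_fin -ltrBrDl; move: taue; rewrite ltr_pdivlMr.
  by apply: le_lt_trans; rewrite mulrDr mulr1 lerDl ltW.
by rewrite ltr_wpDl// sqr_ge0.
Unshelve. all: by end_near.
Qed.
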